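(* Let $m$ be odd, $1\le m\le n$, let $L$ be a simple $m$-self-dual $n$-gon in $\mathbb{CP}^2$, and let $f\colon V\to V^*$ be the corresponding linear isomorphism. Then $f$ is self-adjoint (equivalently, the bilinear form $F(v,w)=\langle f(v),w\rangle$ on $V$ is symmetric) if and only if $m=n$.
   Context: Let $V=\mathbb C^3$, let $P=\mathbb{CP}^2$ be its projectivization and $P^*$ the projectivization of $V^*$. For a point or line $X$ of $P$ (a 1- or 2-dimensional subspace of $V$), $X^*$ denotes its annihilator in $V^*$, which is respectively a line or a point of $P^*$. An $n$-gon in $P$ is a cyclically ordered collection of vertices $A_1,A_3,\dots,A_{2n-1}\in P$ (indices are odd residues modulo $2n$) and sides $B_2,B_4,\dots,B_{2n}$ (indices are even residues modulo $2n$), where $B_{2i}=A_{2i-1}A_{2i+1}$ is the line through $A_{2i-1}$ and $A_{2i+1}$. Polygons are non-degenerate: no three consecutive vertices are collinear. For odd $m$, $1\le m\le n$, an $n$-gon is called $m$-self-dual if there is a projective isomorphism $\hat f\colon P\to P^*$ with $\hat f(A_i)=B_{i+m}^*$ for all $i$; it is induced by a linear isomorphism $f\colon V\to V^*$. Standing convention: for the given $m$-self-dual polygon $\hat f$ is unique, so that $f$ and $F$ are unique up to a non-zero constant factor. For an $n$-gon $L=A_1A_3\dots A_{2n-1}$ and $k\ge1$, $kL$ denotes the $kn$-gon $A_1A_3\dots A_{2kn-1}$ with $A_i=A_{i+2n}$. A polygon $L$ is simple if $L\ne kL'$ for every $k>1$ and every polygon $L'$. *)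

(* Defs.v *)
From HB Require Import structures.
From mathcomp Require Import all_boot all_order all_algebra.
From mathcomp Require Import complex.
From mathcomp Require Import reals zify.

Set Implicit Arguments.
Unset Strict Implicit.
Unset Printing Implicit Defensive.

Import Order.TTheory GRing.Theory Num.Theory.
Local Open Scope ring_scope.

Notation dual V := 'Hom(V, _^o).

Section Duality.
Variable K : fieldType.

Section OneSpace.
Variable V : vectType K.
Implicit Types (U : {vspace V}) (phi : dual V) (v : V).

Definition eval_at v (phi : dual V) : K^o := phi v.

Fact eval_at_is_linear v : linear (eval_at v).
Proof. by move=> a phi psi; rewrite /eval_at !lfun_simp. Qed.
HB.instance Definition _ v :=
  GRing.isLinear.Build K (dual V) K^o *:%R (eval_at v) (eval_at_is_linear v).

Definition bidual_fun v : dual (dual V) := linfun (eval_at v).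

Fact bidual_fun_is_linear : linear bidual_fun.
Proof.
by move=> a u v; apply/lfunP => phi; rewrite !lfun_simp /= /eval_at linearP.
Qed.
HB.instance Definition _ :=
  GRing.isLinear.Build K V (dual (dual V)) *:%R bidual_fun bidual_fun_is_linear.

(* The canonical identification V -> V** *)
Definition bidual : 'Hom(V, dual (dual V)) := linfun bidual_fun.

Lemma bidualE v phi : bidual v phi = phi v.
Proof. by rewrite !lfunE. Qed.

Definition restrict_to U phi : dual V := (phi \o projv U)%VF.

Fact restrict_to_is_linear U : linear (restrict_to U).
Proof. by move=> a phi psi; rewrite /restrict_to comp_lfunDl comp_lfunZl. Qed.
HB.instance Definition _ U :=
  GRing.isLinear.Build K (dual V) (dual V) *:%R (restrict_to U)
    (restrict_to_is_linear U).

Definition annihilator U : {vspace dual V} := lker (linfun (restrict_to U)).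

Lemma memv_annihilator U phi :
  phi \in annihilator U <-> {in U, forall v, phi v = 0}.
Proof.
rewrite memv_ker lfunE /=; split=> [/eqP phi0 v Uv | phi0].
  by move/lfunP/(_ v): phi0; rewrite !lfun_simp projv_id.
by apply/eqP/lfunP => v; rewrite !lfun_simp phi0 // memv_proj.
Qed.

(* Projectivization: the points of P(V) are the lines through 0 in V. *)
Definition proj := {X : {vspace V} | \dim X == 1%N}.

End OneSpace.

Section Transpose.
Variables V W : vectType K.

Definition transpose_fun (f : 'Hom(V, W)) (phi : dual W) : dual V :=
  (phi \o f)%VF.

Fact transpose_fun_is_linear f : linear (transpose_fun f).
Proof. by move=> a phi psi; rewrite /transpose_fun comp_lfunDl comp_lfunZl. Qed.
HB.instance Definition _ f :=
  GRing.isLinear.Build K (dual W) (dual V) *:%R (transpose_fun f)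
    (transpose_fun_is_linear f).

Definition transpose (f : 'Hom(V, W)) : 'Hom(dual W, dual V) :=
  linfun (transpose_fun f).

Definition induces (f : 'Hom(V, W)) (fhat : proj V -> proj W) : Prop :=
  bijective f /\ forall X, val (fhat X) = (f @: val X)%VS.

Definition projective_iso (fhat : proj V -> proj W) : Prop :=
  exists f : 'Hom(V, W), induces f fhat.

End Transpose.

Definition self_adjoint (V : vectType K) (f : 'Hom(V, dual V)) : Prop :=
  (transpose f \o bidual V)%VF = f.

Definition bilin_form (V : vectType K) (f : 'Hom(V, dual V)) (v w : V) : K :=
  f v w.

Lemma self_adjointP (V : vectType K) (f : 'Hom(V, dual V)) :
  self_adjoint f <-> forall v w, bilin_form f v w = bilin_form f w v.
Proof.
have E v w : (transpose f \o bidual V)%VF v w = f w v.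
  by rewrite comp_lfunE [transpose f _]lfunE /= comp_lfunE bidualE.
split=> [sa v w | sym]; first by rewrite /bilin_form -[in LHS]sa E.
by apply/lfunP => v; apply/lfunP => w; rewrite E; apply: sym.
Qed.

End Duality.

Section Polygons.
Variable R : realType.

Definition C3 : vectType R[i] := 'rV[R[i]]_3.

Definition collinear (X Y Z : proj C3) : Prop :=
  exists l : {vspace C3},
    \dim l = 2 /\ [/\ (val X <= l)%VS, (val Y <= l)%VS & (val Z <= l)%VS].

Definition oddz (i : int) : bool := odd `|i|%N.

Fact oddz_add_even (i : int) (k : nat) : oddz i -> oddz (i + (2 * k)%:Z).
Proof. by rewrite /oddz; lia. Qed.

(* Indices modulo 2n are represented by 2n-periodicity over the integers.
   Only the values at odd i are meaningful: all hypotheses and conclusions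
   about vertices, including equality of polygons, are restricted to odd i.
   For n > 0, nondegeneracy forces n >= 3. *)
Record polygon (n : nat) := Polygon {
  vertex : int -> proj C3;
  vertex_period : forall i, oddz i -> vertex (i + (2 * n)%:Z) = vertex i;
  vertex_nondeg : forall i, oddz i ->
    ~ collinear (vertex (i - 2)) (vertex i) (vertex (i + 2)) }.

(* B_j, for even j *)
Definition side n (L : polygon n) (j : int) : {vspace C3} :=
  (val (vertex L (j - 1)) + val (vertex L (j + 1)))%VS.

Definition same_polygon n n' (L : polygon n) (L' : polygon n') : Prop :=
  n = n' /\ forall i, oddz i -> vertex L i = vertex L' i.

Fact multiple_period k n (L : polygon n) i :
  oddz i -> vertex L (i + (2 * (k * n))%:Z) = vertex L i.
Proof.
move=> oi; elim: k => [|k IHk]; first by rewrite mul0n muln0 addr0.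
have -> : i + (2 * (k.+1 * n))%:Z = i + (2 * (k * n))%:Z + (2 * n)%:Z by lia.
by rewrite vertex_period // oddz_add_even.
Qed.

(* kL has the same periodic sequence of vertices as L, read as a kn-gon. *)
Definition multiple k n (L : polygon n) : polygon (k * n) :=
  Polygon (@multiple_period k n L) (@vertex_nondeg n L).

Definition simple n (L : polygon n) : Prop :=
  forall k n' (L' : polygon n'), (1 < k)%N -> ~ same_polygon L (multiple k L').

(* L is m-self-dual when some fhat satisfies this. *)
Definition duality n (L : polygon n) (m : nat)
    (fhat : proj C3 -> proj (dual C3)) : Prop :=
  projective_iso fhat /\
  forall i, oddz i -> val (fhat (vertex L i)) = annihilator (side L (i + m%:Z)).

End Polygons.

(* Main.v *)
Require Import Defs.
From mathcomp Require Import all_boot all_order all_algebra.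
From mathcomp Require Import complex.
From mathcomp Require Import reals.
From mathcomp Require Import zify.

(* If F is the form of f and F^T the transposed form, with map g : V -> V*, then
   the incidences f(A_i) = B_(i+m)^* give g(A_j) = B_(j-m)^* = f(A_(j-2m)).
   If F is symmetric, L is therefore 2m-periodic, hence 2 gcd(m, n)-periodic,
   and simplicity forces m = n. If m = n, then g induces a second n-self-duality,
   so by uniqueness g = c f; transposing twice gives c^2 = 1, and c = -1 is
   excluded because an alternating form in odd dimension is degenerate. *)

Set Implicit Arguments.
Unset Strict Implicit.
Unset Printing Implicit Defensive.

Import Order.TTheory GRing.Theory Num.Theory.
Local Open Scope ring_scope.

Section LinearMaps.
Variables (K : fieldType) (V W : vectType K).

Lemma bijective_lker0 (f : 'Hom(V, W)) : bijective f -> lker f == 0%VS.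
Proof. by move=> [h fK _]; apply/lker0P/(can_inj fK). Qed.

Lemma lker0_bijective (f : 'Hom(V, W)) :
  \dim {:V} = \dim {:W} -> lker f == 0%VS -> bijective f.
Proof.
move=> dimVW kf.
have imf : limg f = fullv.
  by apply/eqP; rewrite eqEdim subvf limg_dim_eq ?(eqP kf) ?capv0 ?dimVW /=.
exists (f^-1)%VF; first exact: lker0_lfunK.
by move=> w; apply: limg_lfunVK; rewrite imf memvf.
Qed.

Lemma dim_limg_inj (f : 'Hom(V, W)) (U : {vspace V}) :
  lker f == 0%VS -> \dim (f @: U) = \dim U.
Proof. by move=> kf; rewrite limg_dim_eq // (eqP kf) capv0. Qed.

(** If c, d, e are the ratios of [g] to [f] at v0, v and v + v0, with v off the line of v0,
    additivity and injectivity of [f] give d v + c v0 = e (v + v0), so all three agree. *)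
Lemma pointwise_proportional (f g : 'Hom(V, W)) :
  lker f == 0%VS -> (forall v, g v \in <[f v]>%VS) -> exists c, g = c *: f.
Proof.
move=> kf gf; have /lker0P f_inj := kf.
(* [vpick] returns 0 only on the zero space, where any constant works. *)
have [v0_eq0 | V0] := eqVneq (vpick {:V}) 0; last first.
  move: (vpick _) V0 => v0 V0.
  have /vlineP[c gv0] := gf v0; exists c; apply/lfunP => v.
  rewrite lfun_simp; have /vlineP[d gv] := gf v.
  have [/vlineP[a ->] | v0'v] := boolP (v \in <[v0]>%VS).
    by rewrite !linearZ /= gv0 !scalerA mulrC.
  have /vlineP[e gvv0] := gf (v + v0).
  have /f_inj : f (d *: v + c *: v0) = f (e *: (v + v0)).
    by rewrite linearD !linearZ /= -gv -gv0 -gvv0 linearD.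
  rewrite scalerDr => /eqP.
  rewrite -subr_eq0 opprD addrACA -!scalerBl => /eqP E.
  have de : d = e.
    apply/eqP; rewrite -subr_eq0; apply: contraNT v0'v => nz.
    apply/vlineP; exists (- ((d - e)^-1 * (c - e))).
    move/eqP: E; rewrite addr_eq0 => /eqP/(congr1 ( *:%R (d - e)^-1)).
    by rewrite scalerN !scalerA mulVf // scale1r scaleNr.
  move/eqP: E; rewrite de subrr scale0r add0r scaler_eq0 (negPf V0) orbF.
  by rewrite subr_eq0 gv de => /eqP->.
exists 0; apply/lfunP => v.
suff -> : v = 0 by rewrite !linear0.
have := memvf v; move/eqP: v0_eq0; rewrite vpick0 => /eqP->.
by rewrite memv0 => /eqP.
Qed.

End LinearMaps.

Section Forms.
Variables (K : fieldType) (V : vectType K).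
Implicit Types f : 'Hom(V, dual V).

(** The map of the transposed form; [self_adjoint f] unfolds to [flip f = f]. *)
Definition flip f : 'Hom(V, dual V) := (transpose f \o bidual V)%VF.

Lemma flipE f v w : flip f v w = f w v.
Proof. by rewrite comp_lfunE [transpose f _]lfunE /= comp_lfunE bidualE. Qed.

Lemma dim_dual : \dim {:V} = \dim {:dual V}.
Proof. by rewrite !dimvf /dim /= muln1. Qed.

Lemma dual_separates v : (forall phi : dual V, phi v = 0) -> v = 0.
Proof.
move=> v0; rewrite (coord_vbasis (memvf v)) big1 // => i _.
have := v0 (linfun (coord (vbasis fullv) i : V -> K^o)).
by rewrite lfunE /= => ->; rewrite scale0r.
Qed.

(** If [flip f v = 0], every functional in the image of [f], hence every functional, vanishes at
    [v]. *)
Lemma flip_bijective f : bijective f -> bijective (flip f).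
Proof.
move=> [h _ hK]; apply: (lker0_bijective dim_dual).
rewrite -subv0; apply/subvP => v; rewrite memv_ker memv0 => /eqP gv0.
by apply/eqP/dual_separates => phi; rewrite -[phi]hK -flipE gv0 zero_lfunE.
Qed.

(** The Gram matrix satisfies M^T = -M, so in odd dimension det M = -det M, and det M = 0. *)
Lemma antisymmetric_degenerate f :
  2%:R != 0 :> K -> odd (\dim {:V}) ->
  (forall v w, f v w = - f w v) -> lker f != 0%VS.
Proof.
move=> nz2 oddV alt; set b := vbasis {:V}.
pose M := \matrix_(i, j < \dim {:V}) (f b`_i b`_j : K).
have detM : \det M = 0.
  have MT : M^T = - M by apply/matrixP => i j; rewrite !mxE alt.
  have := det_tr M; rewrite MT -scaleN1r detZ -signr_odd oddV expr1 mulN1r.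
  move/eqP; rewrite eq_sym -subr_eq0 opprK -mulr2n -mulr_natl mulf_eq0.
  by rewrite (negPf nz2) => /eqP.
have [u nz_u uM] := det0P (introT eqP detM).
apply/negP => /lker0P f_inj; case/negP: nz_u; apply/eqP/rowP => i; rewrite mxE.
(* The value of [f v] at the j-th basis vector is the j-th entry of [u *m M], which is 0. *)
pose v := \sum_j u 0 j *: b`_j.
have fv0 : f v = f 0.
  rewrite linear0; apply/lfunP => w; rewrite zero_lfunE.
  rewrite (coord_vbasis (memvf w)) linear_sum big1 // => j _.
  rewrite linearZ /= -/b /v linear_sum sum_lfunE.
  have /rowP/(_ j) := uM; rewrite !mxE => E.
  rewrite -[RHS](scaler0 _ (coord b j w)); congr (_ *: _).
  rewrite -[RHS]E; apply: eq_bigr => k _.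
  by rewrite linearZ /= lfun_simp mxE.
have /freeP/(_ (u 0)) := basis_free (vbasisP {:V}).
by apply; apply: f_inj.
Qed.

Lemma proportional_flip_self_adjoint f c :
  2%:R != 0 :> K -> odd (\dim {:V}) -> lker f == 0%VS ->
  flip f = c *: f -> self_adjoint f.
Proof.
move=> nz2 oddV kf fc.
have fE v w : f w v = c * f v w by rewrite -[f w v]flipE fc !scale_lfunE.
have [c1 | nc1] := eqVneq c 1.
  by rewrite /self_adjoint -/(flip f) fc c1 scale1r.
suff /(antisymmetric_degenerate nz2 oddV)/negP :
  forall v w, f v w = - f w v by case.
move=> w v; have [fwv | nz] := eqVneq (f w v) 0.
  by rewrite (fE w v) fwv mulr0 oppr0.
(* Applying [fE] twice gives f w v = c^2 f w v. *)
have : (c - 1) * (c + 1) * f w v == 0.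
  by rewrite -subr_sqr expr1n mulrBl mul1r expr2 -mulrA -fE -fE subrr.
rewrite !mulf_eq0 (negPf nz) orbF subr_eq0 (negPf nc1) addr_eq0 => /eqP c1.
by rewrite fE c1 mulN1r.
Qed.

End Forms.

Section SelfDuality.
Variables (R : realType) (n m : nat) (L : polygon R n).
Variable f : 'Hom(C3 R, dual (C3 R)).
Hypothesis odd_m : odd m.
Hypothesis f_bij : bijective f.
Hypothesis f_vertex : forall i, oddz i ->
  (f @: val (vertex L i))%VS = annihilator (side L (i + m%:Z)).

(** For i = j - m - 1 and i = j - m + 1, the vertex A_j lies on B_(i+m), so f(A_i) kills A_j. These
    two A_i span B_(j-m), which gives one inclusion; dimensions give equality. *)
Lemma flip_vertex j : oddz j ->
  (flip f @: val (vertex L j))%VS = annihilator (side L (j - m%:Z)).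
Proof.
move=> oj.
have oj2 : oddz (j - (2 * m)%:Z) by move: oj; rewrite /oddz; lia.
have dim1 i : \dim (val (vertex L i)) = 1%N by apply/eqP/(valP (vertex L i)).
have kf := bijective_lker0 f_bij.
have kg := bijective_lker0 (flip_bijective f_bij).
(* This annihilator is f(A_(j-2m)), the injective image of a point. *)
have dim_ann : \dim (annihilator (side L (j - m%:Z))) = 1%N.
  have -> : j - m%:Z = j - (2 * m)%:Z + m%:Z by lia.
  by rewrite -(f_vertex oj2) (dim_limg_inj _ kf); apply: dim1.
apply/eqP; rewrite eqEdim dim_ann (dim_limg_inj _ kg) dim1 leqnn andbT.
have vanish i v w : oddz i -> v \in val (vertex L j) -> w \in val (vertex L i) ->
    (j = i + m%:Z - 1) \/ (j = i + m%:Z + 1) -> flip f v w = 0.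
  move=> oi vj wi ji; rewrite flipE.
  have : f w \in annihilator (side L (i + m%:Z)) by rewrite -f_vertex // memv_img.
  move=> /memv_annihilator; apply; rewrite /side.
  by case: ji => <-; [apply: (subvP (addvSl _ _)) | apply: (subvP (addvSr _ _))].
apply/subvP => _ /memv_imgP[v vj ->]; apply/memv_annihilator => w.
case/memv_addP => w1 w1i [w2 w2i ->]; rewrite linearD /=.
rewrite (vanish _ v w1 _ vj w1i) ?(vanish _ v w2 _ vj w2i) ?addr0 //;
  by [move: oj odd_m; rewrite /oddz; lia | lia].
Qed.

(** With [flip f = f], the injective [f] sends both A_j and A_(j+2m) to the annihilator of
    B_(j+m). *)
Lemma self_adjoint_period j : self_adjoint f -> oddz j ->
  vertex L (j + (2 * m)%:Z) = vertex L j.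
Proof.
move=> sa oj; apply: val_inj.
have oj2 : oddz (j + (2 * m)%:Z) by apply: oddz_add_even.
have := flip_vertex oj2; rewrite [flip f]sa.
have -> : j + (2 * m)%:Z - m%:Z = j + m%:Z by lia.
rewrite -(f_vertex oj) => /eqP.
by rewrite (eq_limg_ker0 _ _ (bijective_lker0 f_bij)) => /eqP.
Qed.

End SelfDuality.

Lemma simple_period (R : realType) (n m : nat) (L : polygon R n) :
  (0 < m)%N -> (0 < n)%N -> simple L ->
  (forall i, oddz i -> vertex L (i + (2 * m)%:Z) = vertex L i) -> (n %| m)%N.
Proof.
move=> m_gt0 n_gt0 simL per.
(* The same vertices read as an m-gon, so that [multiple_period] also covers shifts by multiples of
   2m. *)
pose Lm := Polygon per (@vertex_nondeg _ _ L).
have perg i : oddz i -> vertex L (i + (2 * gcdn m n)%:Z) = vertex L i.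
  (* Bezout over the naturals: u m = v n + gcd(m, n). *)
  move=> oi; case: (egcdnP n m_gt0) => u v uv _.
  rewrite -(multiple_period v L) ?oddz_add_even //.
  have -> : i + (2 * gcdn m n)%:Z + (2 * (v * n))%:Z = i + (2 * (u * m))%:Z by lia.
  exact: (multiple_period u Lm).
pose Lg := Polygon perg (@vertex_nondeg _ _ L).
have ndvd : (gcdn m n %| n)%N := dvdn_gcdr m n.
(* [L] is the n / gcd(m, n)-fold multiple of [Lg], so simplicity makes this quotient 1. *)
have := simL (n %/ gcdn m n)%N _ Lg; case: leqP => [le1 _ | _ /(_ isT)[]].
  suff <- : gcdn m n = n by apply: dvdn_gcdl.
  have := divnK ndvd.
  have : (0 < n %/ gcdn m n)%N by rewrite divn_gt0 ?gcdn_gt0 ?m_gt0 // dvdn_leq.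
  by case: (n %/ _)%N le1 => [|[|]] // _ _; rewrite mul1n.
by split; rewrite // divnK.
Qed.

Theorem proposition2 (R : realType) (n m : nat) (L : polygon R n)
    (fhat : proj (C3 R) -> proj (dual (C3 R))) (f : 'Hom(C3 R, dual (C3 R))) :
  odd m -> (1 <= m <= n)%N ->
  simple L ->
  duality L m fhat ->
  (forall ghat, duality L m ghat -> ghat =1 fhat) ->
  induces f fhat ->
  (self_adjoint f <-> m = n) /\
  ((forall v w, bilin_form f v w = bilin_form f w v) <-> m = n).
Proof.
move=> odd_m /andP[m_gt0 le_mn] simL [_ fhatL] fhat_uniq [f_bij fhatE].
suff sa : self_adjoint f <-> m = n.
  by split=> //; apply: iff_trans sa; apply: iff_sym; apply: self_adjointP.
have n_gt0 : (0 < n)%N by apply: leq_trans le_mn.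
have f_vertex i : oddz i ->
    (f @: val (vertex L i))%VS = annihilator (side L (i + m%:Z)).
  by move=> oi; rewrite -fhatE fhatL.
split=> [sa | mn].
  apply/eqP; rewrite eqn_leq le_mn dvdn_leq //; apply: simple_period simL _ => //.
  by move=> i; apply: (self_adjoint_period odd_m f_bij f_vertex sa).
have kf := bijective_lker0 f_bij.
have g_bij := flip_bijective f_bij; have kg := bijective_lker0 g_bij.
have dimg (X : proj (C3 R)) : \dim (flip f @: val X) == 1%N.
  by rewrite (dim_limg_inj _ kg); apply: (valP X).
pose ghat X : proj (dual (C3 R)) := exist _ (flip f @: val X)%VS (dimg X).
have ghatL : duality L m ghat.
  split=> [|i oi]; first by exists (flip f); split.
  (* The two indices differ by 2m = 2n, a full period. *)
  suff -> : side L (i + m%:Z) = side L (i - m%:Z).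
    exact: (flip_vertex odd_m f_bij f_vertex oi).
  have shift k : oddz k -> vertex L (k + (2 * m)%:Z) = vertex L k.
    by move=> ok; rewrite mn vertex_period.
  rewrite /side -(shift (i - m%:Z - 1)) -?(shift (i - m%:Z + 1)).
  - by congr (val (vertex L _) + val (vertex L _))%VS; lia.
  - by move: oi odd_m; rewrite /oddz; lia.
  - by move: oi odd_m; rewrite /oddz; lia.
have [c] : exists c, flip f = c *: f.
  apply: pointwise_proportional => // v.
  have [-> | nz_v] := eqVneq v 0; first by rewrite !linear0 mem0v.
  have dimv : \dim <[v]> == 1%N by rewrite dim_vline nz_v.
  (* Uniqueness at the point spanned by [v] says that [f v] and [flip f v] span the same line. *)
  have /(congr1 val) := fhat_uniq _ ghatL (exist _ <[v]>%VS dimv).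
  rewrite fhatE /= !limg_line => <-; exact: memv_line.
apply: proportional_flip_self_adjoint => //; first by rewrite pnatr_eq0.
by rewrite dimvf /dim.
Qed.
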